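(* Let $\tau$ and $\nu$ be generalized patterns with no hyphens, and let $\phi=\tau\mbox{-}\ell\mbox{-}\nu$ be the shuffle pattern consisting of $\tau$, a hyphen, a letter $\ell$, a hyphen, and $\nu$, where $\ell$ is greater than every letter of $\tau$ and of $\nu$, and every letter of $\tau$ is incomparable with every letter of $\nu$. Then for all $k\ge \ell$, $$A_\phi(x;k)=\frac{1}{(1-xA_\tau(x;k-1))(1-xA_\nu(x;k-1))}\Bigl(A_\phi(x;k-1)-xA_\tau(x;k-1)A_\nu(x;k-1)\Bigr).$$
   Context: $[k]=\{1,\dots,k\}$, $[k]^n$ = words of length $n$ over $[k]$. A generalized pattern is a word over $[m]$ using every letter of $[m]$, with possibly hyphens between some consecutive letters. A partially ordered generalized pattern (POGP) has letters from a partially ordered set; a word $\sigma=\sigma_1\cdots\sigma_n$ contains a POGP $\pi=\pi_1\cdots\pi_r$ if there are indices $i_1<\dots<i_r$ such that $i_{j+1}=i_j+1$ whenever $\pi_j,\pi_{j+1}$ are not separated by a hyphen, and for every pair of positions $a,b$ whose letters are comparable (identical letters are equal), $\sigma_{i_a},\sigma_{i_b}$ stand in the same relation ($<$, $=$, $>$) as $\pi_a,\pi_b$; incomparable pairs are unconstrained. Otherwise $\sigma$ avoids $\pi$. For a POGP $\pi$, $A_\pi(x;k)=\sum_{n\ge0}a_\pi(n;k)x^n$ with $a_\pi(n;k)$ the number of words in $[k]^n$ avoiding $\pi$ ($a_\pi(0;k)=1$). Here $\ell$ denotes the integer value of the middle letter of $\phi$. *)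

(* Defs.v *)
From HB Require Import structures.
From mathcomp Require Import all_boot all_order all_algebra.
From mathcomp Require Import boolp.

Set Implicit Arguments.
Unset Strict Implicit.
Unset Printing Implicit Defensive.

Import Order.TTheory GRing.Theory.
Local Open Scope ring_scope.

(** * Formal power series *)

Record fps (R : Type) := FPS { fps_coef : nat -> R }.

Section FpsRing.
Variable R : comUnitRingType.
Implicit Types f g h : fps R.

Lemma fpsP f g : (forall n, fps_coef f n = fps_coef g n) -> f = g.
Proof. by case: f g => [f] [g] /= /funext ->. Qed.

HB.instance Definition _ := gen_eqMixin (fps R).
HB.instance Definition _ := gen_choiceMixin (fps R).

Definition fps_zero : fps R := FPS (fun=> 0).
Definition fps_one : fps R := FPS (fun n => (n == 0%N)%:R).
Definition fps_opp f : fps R := FPS (fun n => - fps_coef f n).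
Definition fps_add f g : fps R := FPS (fun n => fps_coef f n + fps_coef g n).
Definition fps_mul f g : fps R :=
  FPS (fun n => \sum_(i < n.+1) fps_coef f i * fps_coef g (n - i)%N).

Fact fps_addA : associative fps_add.
Proof. by move=> f g h; apply: fpsP => n /=; rewrite addrA. Qed.
Fact fps_addC : commutative fps_add.
Proof. by move=> f g; apply: fpsP => n /=; rewrite addrC. Qed.
Fact fps_add0 : left_id fps_zero fps_add.
Proof. by move=> f; apply: fpsP => n /=; rewrite add0r. Qed.
Fact fps_addN : left_inverse fps_zero fps_opp fps_add.
Proof. by move=> f; apply: fpsP => n /=; rewrite addNr. Qed.

HB.instance Definition _ :=
  GRing.isZmodule.Build (fps R) fps_addA fps_addC fps_add0 fps_addN.

Definition fps_trunc n f : {poly R} := \poly_(i < n) fps_coef f i.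

Lemma coef_fps_mul n f g m : (m < n)%N ->
  fps_coef (fps_mul f g) m = (fps_trunc n f * fps_trunc n g)`_m.
Proof.
move=> lt_mn; rewrite coefM; apply: eq_bigr => i _.
by rewrite !coef_poly (leq_trans (ltn_ord i)) // (leq_ltn_trans (leq_subr _ _)).
Qed.

Fact fps_mulC : commutative fps_mul.
Proof. by move=> f g; apply: fpsP => n; rewrite !(@coef_fps_mul n.+1) // mulrC. Qed.

Fact fps_mulA : associative fps_mul.
Proof.
move=> f g h; apply: fpsP => n; pose t := fps_trunc n.+1.
transitivity ((t f * (t g * t h))`_n).
  rewrite coefM; apply: eq_bigr => i _.
  rewrite (@coef_fps_mul n.+1) ?coef_poly ?ltn_ord //.
  by rewrite ltnS leq_subr.
rewrite mulrA coefM; apply: eq_bigr => i _.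
rewrite (@coef_fps_mul n.+1) ?ltn_ord //.
by rewrite [(t h)`__]coef_poly ltnS leq_subr.
Qed.

Fact fps_mul1 : left_id fps_one fps_mul.
Proof.
move=> f; apply: fpsP => n /=; rewrite big_ord_recl /= mul1r subn0.
by rewrite big1 ?addr0 // => i _; rewrite mul0r.
Qed.

Fact fps_mulDl : left_distributive fps_mul fps_add.
Proof.
move=> f g h; apply: fpsP => n /=; rewrite -big_split /=.
by apply: eq_bigr => i _; rewrite mulrDl.
Qed.

Fact fps_one_neq0 : fps_one != 0.
Proof.
apply/eqP => /(congr1 (fun f => fps_coef f 0)) /= /eqP.
by rewrite oner_eq0.
Qed.

HB.instance Definition _ := GRing.Zmodule_isComNzRing.Build (fps R)
  fps_mulA fps_mulC fps_mul1 fps_mulDl fps_one_neq0.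

(* [fps_inv_seq f n] lists the coefficients n, n-1, ..., 0 of 1/f. *)
Fixpoint fps_inv_seq f (n : nat) : seq R :=
  if n is n'.+1 then
    let s := fps_inv_seq f n' in
    - ((fps_coef f 0)^-1 * \sum_(i < n) fps_coef f i.+1 * s`_i) :: s
  else [:: (fps_coef f 0)^-1].

Definition fps_unit : pred (fps R) := fun f => fps_coef f 0 \is a GRing.unit.
(* The inverse of a non-unit is, by library convention, itself. *)
Definition fps_inv f : fps R :=
  if fps_unit f then FPS (fun n => (fps_inv_seq f n)`_0) else f.

Lemma nth_fps_inv_seq f n i : (i <= n)%N ->
  (fps_inv_seq f n)`_i = (fps_inv_seq f (n - i))`_0.
Proof.
elim: n i => [|n IHn] [|i] // le_in.
by rewrite subSS -IHn.
Qed.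

Fact fps_mulVr : {in fps_unit, left_inverse 1 fps_inv *%R}.
Proof.
move=> f Uf; have f0U : fps_coef f 0 \is a GRing.unit := Uf.
rewrite mulrC; apply: fpsP => n.
rewrite /fps_inv ifT //= big_ord_recl /= subn0.
case: n => [|n]; first by rewrite big_ord0 addr0 mulrV.
rewrite /= mulrN mulrA mulrV // mul1r; apply/eqP.
rewrite addrC subr_eq0; apply/eqP; apply: eq_bigr => i _.
by rewrite (@nth_fps_inv_seq f n i) ?subSS // -ltnS.
Qed.

Fact fps_unitP f g : g * f = 1 -> fps_unit f.
Proof.
move=> /(congr1 (fun h => fps_coef h 0)) /=.
rewrite big_ord_recl big_ord0 addr0 /= => gf1.
by apply/unitrPr; exists (fps_coef g 0); rewrite mulrC.
Qed.

Fact fps_inv_out : {in [predC fps_unit], fps_inv =1 id}.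
Proof. by move=> f; rewrite /fps_inv; case: ifP => // fU /negP[]. Qed.

HB.instance Definition _ := GRing.ComNzRing_hasMulInverse.Build (fps R)
  fps_mulVr fps_unitP fps_inv_out.

Definition fpsX : fps R := FPS (fun n => (n == 1%N)%:R).

End FpsRing.

Arguments fpsX {R}.

(** * Patterns *)

(* A POGP is given by the list of its maximal hyphen-free factors: pi_1 pi_2-pi_3
   is [:: [:: pi_1; pi_2]; [:: pi_3]].  A pattern without hyphens is [:: s]. *)
Definition pogp (T : Type) := seq (seq T).

Definition pogp_size (T : Type) (pi : pogp T) : nat := size (flatten pi).

Definition pogp_letter (T : Type) (pi : pogp T) (a : 'I_(pogp_size pi)) : T :=
  tnth (in_tuple (flatten pi)) a.

Definition same_factor (T : Type) (pi : pogp T) (a b : nat) : bool :=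
  reshape_index (shape pi) a == reshape_index (shape pi) b.

(* Words in [k]^n are n-tuples over 'I_k, the letter j+1 being encoded as j.
   The clause for ">" is the clause for "<" with a and b exchanged. *)
Definition contains (d : Order.disp_t) (T : porderType d) (pi : pogp T)
    (k n : nat) (w : n.-tuple 'I_k) : bool :=
  let r := pogp_size pi in
  [exists i : {ffun 'I_r -> 'I_n},
    [&& [forall a : 'I_r, forall b : 'I_r, (a < b)%N ==> (i a < i b)%N],
        [forall a : 'I_r, forall b : 'I_r,
           (b == a.+1 :> nat) && same_factor pi a b ==>
           (i b == (i a).+1 :> nat)],
        [forall a : 'I_r, forall b : 'I_r,
           (pogp_letter a < pogp_letter b)%O ==>
           (tnth w (i a) < tnth w (i b))%N]
      & [forall a : 'I_r, forall b : 'I_r,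
           (pogp_letter a == pogp_letter b) ==>
           (tnth w (i a) == tnth w (i b))]]].

Definition avoid_count (d : Order.disp_t) (T : porderType d) (pi : pogp T)
    (k n : nat) : nat :=
  #|[set w : n.-tuple 'I_k | ~~ contains pi w]|.

Definition avoid_gf (d : Order.disp_t) (T : porderType d) (pi : pogp T)
    (k : nat) : fps rat :=
  FPS (fun n => (avoid_count pi k n)%:R).

Definition generalized_pattern (pi : pogp nat) : Prop :=
  exists m, flatten pi =i iota 1 m.

(** * Shuffle patterns *)

(* Marked integers: [LeftL a] is a letter a of tau, [RightL a] a letter a of nu,
   [MidL a] an unmarked integer a, which lies above the marked integers smaller
   than a and below none of them. *)
Inductive shuffle_letter := LeftL of nat | MidL of nat | RightL of nat.

Definition shuffle_letter_code (x : shuffle_letter) : nat + nat + nat :=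
  match x with
  | LeftL a => inl (inl a) | MidL a => inl (inr a) | RightL a => inr a
  end.

Definition shuffle_letter_decode (x : nat + nat + nat) : shuffle_letter :=
  match x with
  | inl (inl a) => LeftL a | inl (inr a) => MidL a | inr a => RightL a
  end.

Fact shuffle_letter_codeK : cancel shuffle_letter_code shuffle_letter_decode.
Proof. by case. Qed.

HB.instance Definition _ :=
  Countable.copy shuffle_letter (can_type shuffle_letter_codeK).

Definition shuffle_le (x y : shuffle_letter) : bool :=
  match x, y with
  | LeftL a, LeftL b | MidL a, MidL b | RightL a, RightL b => (a <= b)%N
  | LeftL a, MidL b | RightL a, MidL b => (a < b)%N
  | _, _ => false
  end.

Fact shuffle_le_refl : reflexive shuffle_le.
Proof. by case=> a /=. Qed.

Fact shuffle_le_anti : antisymmetric shuffle_le.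
Proof. by case=> a [] b //=; rewrite ?andbF // -eqn_leq => /eqP ->. Qed.

Fact shuffle_le_trans : transitive shuffle_le.
Proof.
by case=> b [] a [] c //=;
  first [exact: leq_trans | exact: leq_ltn_trans
        | by move=> ltab lebc; apply: leq_trans lebc].
Qed.

Fact shuffle_display : Order.disp_t. Proof. exact: Order.Disp tt tt. Qed.

HB.instance Definition _ := Order.Le_isPOrder.Build shuffle_display
  shuffle_letter shuffle_le_refl shuffle_le_anti shuffle_le_trans.

Definition shuffle_pattern (tau : seq nat) (l : nat) (nu : seq nat) :
    pogp shuffle_letter :=
  [:: map LeftL tau; [:: MidL l]; map RightL nu].

(* Main.v *)
Require Import Defs.
From mathcomp Require Import all_boot all_order all_algebra.
From mathcomp Require Import boolp zify ring.

(** Let [m] be the largest letter of [[k]].  A word with an [m] splits uniquely as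
    [u m v] with [u] free of [m].  Occurrences of [tau] and [nu] inside an
    occurrence of [phi] are contiguous and avoid [m], so [u m v] contains [phi] iff
    [u] does, or [v] does, or [u] contains [tau] and [v] contains [nu] (in letters
    below [m]).  Hence, with [B] the series of the words over [[k]] avoiding [nu] in
    the letters below [m] and all other series on the right over [[k-1]],
      [A_phi(k) = A_phi + x A_tau A_phi(k) + x (A_phi - A_tau) B]
    and [B = A_nu + x A_nu B]; eliminating [B] gives the formula. *)

Set Implicit Arguments.
Unset Strict Implicit.

Import GRing.Theory.

(** * Occurrences in words of natural numbers, and cutting a word at a letter *)

(** The bound [m] plays the middle letter of the shuffle, while [w] itself may use letters [>= m].
    The relation [>] is covered by exchanging [a] and [b]. *)
Definition occurs (s : seq nat) (m : nat) (w : seq nat) : Prop :=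
  exists i : nat, [/\ (i + size s <= size w)%N,
    forall a : nat, (a < size s)%N -> (nth 0 w (i + a) < m)%N &
    forall a b : nat, (a < size s)%N -> (b < size s)%N ->
      ((nth 0 s a < nth 0 s b)%N -> (nth 0 w (i + a) < nth 0 w (i + b))%N) /\
      (nth 0 s a = nth 0 s b -> nth 0 w (i + a) = nth 0 w (i + b))].

(** The middle letter survives only as the strict bound [c] on both sides. Nothing relates the
    letters of the two sides, which renders incomparability. *)
Definition occurs_shuffle (s t w : seq nat) : Prop :=
  exists x c y, [/\ w = x ++ c :: y, occurs s c x & occurs t c y].

Lemma occurs_leq (s : seq nat) (m m' : nat) (w : seq nat) :
  (m <= m')%N -> occurs s m w -> occurs s m' w.
Proof.
move=> le_mm' [i [szi lt_m ord_i]]; exists i; split=> // a /lt_m lt_am.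
exact: leq_trans lt_am le_mm'.
Qed.

Lemma occurs_catl (s : seq nat) (m : nat) (u v : seq nat) :
  occurs s m u -> occurs s m (u ++ v).
Proof.
case=> i [szi lt_m ord_i]; have nthE a : (a < size s)%N ->
  nth 0 (u ++ v) (i + a) = nth 0 u (i + a).
  by move=> lt_as; rewrite nth_cat ifT //; lia.
exists i; split; first by rewrite size_cat; lia.
  by move=> a lt_as; rewrite nthE //; apply: lt_m.
by move=> a b lt_as lt_bs; rewrite !nthE //; apply: ord_i.
Qed.

Lemma occurs_catr (s : seq nat) (m : nat) (u v : seq nat) :
  occurs s m v -> occurs s m (u ++ v).
Proof.
case=> i [szi lt_m ord_i]; have nthE a :
  nth 0 (u ++ v) (size u + i + a) = nth 0 v (i + a).
  by rewrite nth_cat ifF; [congr nth; lia | lia].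
exists (size u + i)%N; split; first by rewrite size_cat; lia.
  by move=> a lt_as; rewrite nthE //; apply: lt_m.
by move=> a b lt_as lt_bs; rewrite !nthE //; apply: ord_i.
Qed.

(* An occurrence is contiguous and has letters below [m], so it cannot straddle [c]. *)
Lemma occurs_split (s : seq nat) (m c : nat) (u v : seq nat) :
  (m <= c)%N -> occurs s m (u ++ c :: v) -> occurs s m u \/ occurs s m v.
Proof.
move=> le_mc [i [szi lt_m ord_i]]; rewrite size_cat /= in szi.
have [le_su|gt_su] := leqP (i + size s) (size u).
  left; have nthE a : (a < size s)%N ->
    nth 0 u (i + a) = nth 0 (u ++ c :: v) (i + a).
    by move=> lt_as; rewrite nth_cat ifT //; lia.
  exists i; split=> // [a lt_as|a b lt_as lt_bs].
    by rewrite nthE //; apply: lt_m.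
  by rewrite !nthE //; apply: ord_i.
have [le_iu|lt_ui] := leqP i (size u).
  have [s0|s_gt0] := posnP (size s).
    by right; exists 0%N; rewrite s0; split=> //; lia.
  (* Here the occurrence starts no later than [c] and ends no earlier, so its offset [size u - i]
     carries [c], which would force [c < m]. *)
  have := lt_m (size u - i)%N; rewrite nth_cat ifF; last by lia.
  rewrite (_ : (i + (size u - i) - size u = 0)%N); last by lia.
  move=> /= H; suff: (c < m)%N by lia.
  by apply: H; lia.
right; have nthE a : nth 0 v (i - (size u).+1 + a) = nth 0 (u ++ c :: v) (i + a).
  rewrite nth_cat ifF; last by lia.
  by rewrite (_ : (i + a - size u = (i - (size u).+1 + a).+1)%N) //; lia.
exists (i - (size u).+1)%N; split; first by lia.
  by move=> a lt_as; rewrite nthE //; apply: lt_m.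
by move=> a b lt_as lt_bs; rewrite !nthE //; apply: ord_i.
Qed.

(** Serves to locate the middle letter of an occurrence of the shuffle relative to the cut letter
    [k]. *)
Lemma eq_cat_cons (T : Type) (x y u v : seq T) (c d : T) :
  x ++ c :: y = u ++ d :: v ->
  [\/ exists2 z, u = x ++ c :: z & y = z ++ d :: v,
      [/\ x = u, c = d & y = v] |
      exists2 z, x = u ++ d :: z & v = z ++ c :: y].
Proof.
elim: x u => [|a x IHx] [|b u] /=.
- by case=> -> ->; constructor 2.
- by case=> -> ->; constructor 1; exists u.
- by case=> -> <-; constructor 3; exists x.
case=> -> /IHx[[z -> ->]|[-> -> ->]|[z -> ->]].
- by constructor 1; exists z.
- by constructor 2.
- by constructor 3; exists z.
Qed.

(** If the middle letter [c] lies in [v], then [nu] occurs inside [v], and [k >= c] forces the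
    occurrence of [tau] to one side of [k]: in [v] it completes a shuffle there, in [u] it gives the
    third case once the bound is raised to [k]. The case of [c] in [u] is symmetric. *)
Lemma occurs_shuffle_split (s t : seq nat) (k : nat) (u v : seq nat) :
  all (fun c => c < k)%N u -> all (fun c => c < k.+1)%N v ->
  occurs_shuffle s t (u ++ k :: v) <->
  [\/ occurs_shuffle s t u, occurs_shuffle s t v | occurs s k u /\ occurs t k v].
Proof.
move=> lt_uk le_vk; split=> [[x [c [y [eq_w sx ty]]]]|].
  case: (eq_cat_cons eq_w) => [[z xE vE]|[-> -> ->]|[z uE yE]].
  - move: le_vk sx; rewrite xE vE all_cat /= => /and3P[_ /ltnSE le_ck _].
    case/(occurs_split le_ck) => [su|sz]; last by constructor 2; exists z, c, y.
    constructor 3; split; first exact: occurs_leq su.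
    by apply: occurs_catr; rewrite -cat1s; apply/occurs_catr/(occurs_leq le_ck).
  - by constructor 3.
  - move: lt_uk ty; rewrite uE yE all_cat /= => /and3P[_ lt_ck _].
    case/(occurs_split (ltnW lt_ck)) => [tz|tv].
      by constructor 1; exists x, c, z.
    constructor 3; split; last exact: occurs_leq (ltnW lt_ck) tv.
    by apply: occurs_catl; exact: occurs_leq (ltnW lt_ck) sx.
case=> [[x [c [y [-> sx ty]]]]|[x [c [y [-> sx ty]]]]|[su tv]].
- by exists x, c, (y ++ k :: v); rewrite -catA; split=> //; apply: occurs_catl.
- exists (u ++ k :: x), c, y; rewrite -catA; split=> //.
  by apply: occurs_catr; rewrite -cat1s; apply: occurs_catr.
- by exists u, k, v.
Qed.

(** The bound rises from [c <= k] to [k]. With this inclusion, the difference of the series for the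
    shuffle and for [tau] counts the words that contain [tau] and avoid the shuffle. *)
Lemma occurs_shuffle_l (s t : seq nat) (k : nat) (w : seq nat) :
  all (fun c => c < k.+1)%N w -> occurs_shuffle s t w -> occurs s k w.
Proof.
move=> le_wk [x [c [y [wE sx _]]]]; move: le_wk; rewrite wE all_cat /= => /and3P[_ /ltnSE le_ck _].
by apply: occurs_catl; apply: occurs_leq sx.
Qed.

Lemma occurs_shuffle_r (s t : seq nat) (k : nat) (w : seq nat) :
  all (fun c => c < k.+1)%N w -> occurs_shuffle s t w -> occurs t k w.
Proof.
move=> le_wk [x [c [y [wE _ ty]]]]; move: le_wk; rewrite wE all_cat /= => /and3P[_ /ltnSE le_ck _].
by apply: occurs_catr; rewrite -cat1s; apply/occurs_catr/(occurs_leq le_ck).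
Qed.

(** * Translation of pattern containment into occurrences *)

(** Trades functions between ordinals for functions on [nat] constrained only below [r], so that
    positions obey plain arithmetic. *)
Lemma containsP (d : Order.disp_t) (T : porderType d) (x0 : T) (pi : pogp T)
    (k n : nat) (w : n.-tuple 'I_k) :
  let r := pogp_size pi in
  let p := nth x0 (flatten pi) in
  let W := nth 0%N (map (@nat_of_ord k) w) in
  contains pi w <->
  exists f : nat -> nat,
    [/\ forall a, (a < r)%N -> (f a < n)%N,
        forall a b, (a < b < r)%N -> (f a < f b)%N,
        forall a, (a.+1 < r)%N -> same_factor pi a a.+1 -> f a.+1 = (f a).+1,
        forall a b, (a < r)%N -> (b < r)%N -> (p a < p b)%O -> (W (f a) < W (f b))%N &
        forall a b, (a < r)%N -> (b < r)%N -> p a = p b -> W (f a) = W (f b)].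
Proof.
move=> r p W.
have WE (j : 'I_n) : W j = tnth w j.
  rewrite /W (tnth_nth (tnth w j)) (nth_map (tnth w j)) //.
  by rewrite size_tuple.
have pE (a : 'I_r) : pogp_letter a = p a by rewrite /pogp_letter (tnth_nth x0).
split.
  case/existsP=> i /and4P[/'forall_'forall_implyP incr /'forall_'forall_implyP adj].
  move=> /'forall_'forall_implyP lt_p /'forall_'forall_implyP eq_p.
  pose f a := if insub a is Some j then nat_of_ord (i j) else 0%N.
  have fE a (lt_ar : (a < r)%N) : f a = i (Ordinal lt_ar) by rewrite /f insubT.
  exists f; split=> [a lt_ar|a b /andP[lt_ab lt_br]|a lt_ar sf|a b lt_ar lt_br|a b lt_ar lt_br].
  - by rewrite fE.
  - have lt_ar := ltn_trans lt_ab lt_br.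
    by rewrite !fE; apply: incr.
  - have lt_ar' := ltnW lt_ar.
    by rewrite !fE; apply/eqP; apply: adj; rewrite eqxx.
  - move=> lt_pab; rewrite !fE !WE; apply: lt_p; by rewrite !pE.
  - move=> eq_pab; rewrite !fE !WE; congr nat_of_ord; apply/eqP; apply: eq_p.
    by rewrite !pE; apply/eqP.
case=> f [f_lt incr adj lt_p eq_p]; apply/existsP.
exists [ffun a : 'I_r => Ordinal (f_lt a (ltn_ord a))].
apply/and4P; split; apply/'forall_'forall_implyP => a b; rewrite !ffunE /=.
- by move=> lt_ab; apply: incr; rewrite lt_ab /=.
- case/andP=> /eqP bE; rewrite bE => sf; apply/eqP; apply: adj => //.
  by rewrite -bE.
- by rewrite !pE => /lt_p; rewrite -!WE; apply.
- rewrite !pE => /eqP /eq_p -/(_ (ltn_ord a) (ltn_ord b)) eqW.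
  by apply/eqP/val_inj; rewrite /= -!WE.
Qed.

Lemma shuffle_ltE (x y : shuffle_letter) : (x < y)%O =
  match x, y with
  | LeftL a, LeftL b | MidL a, MidL b | RightL a, RightL b
  | LeftL a, MidL b | RightL a, MidL b => a < b
  | _, _ => false
  end.
Proof.
by rewrite Order.POrderTheory.lt_leAnge /Order.le; case: x y => a [] b /=; lia.
Qed.

(** An embedding is a translation on each hyphen-free factor, hence is determined there by one
    starting index. *)
Lemma consecutive (f : nat -> nat) (m r : nat) :
  (forall a, m <= a -> a.+1 < r -> f a.+1 = (f a).+1) ->
  forall a, m + a < r -> f (m + a) = f m + a.
Proof.
move=> fS; elim=> [|a IHa] lt_ar; first by rewrite !addn0.
by rewrite !addnS in lt_ar *; rewrite fS ?IHa //; lia.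
Qed.

Lemma contains_factor (s : seq nat) (k n : nat) (w : n.-tuple 'I_k) :
  contains ([:: s] : pogp nat) w <-> occurs s k (map (@nat_of_ord k) w).
Proof.
have szW : size (map (@nat_of_ord k) w) = n by rewrite size_map size_tuple.
have W_lt j : j < n -> nth 0 (map (@nat_of_ord k) w) j < k.
  have /(all_nthP 0) allW : all (fun c => c < k) (map (@nat_of_ord k) w).
    by rewrite all_map; apply/allP => c _ /=.
  by move=> lt_jn; apply: allW; rewrite szW.
have := containsP 0 [:: s] w; rewrite /pogp_size /= cats0 => ->.
have sf a : a.+1 < size s -> same_factor [:: s] a a.+1.
  move=> lt_as; rewrite /same_factor /reshape_index /=.
  by rewrite !ifT //; lia.
split.
  case=> f [f_lt _ adj lt_p eq_p].
  have fE a : a < size s -> f a = f 0 + a.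
    by apply: (@consecutive f 0) => b _ lt_bs; apply: adj => //; apply: sf.
  (* For an empty pattern [f 0] is unconstrained and could exceed the word, so [0] is the
     witness. *)
  have [s0|s_gt0] := posnP (size s); first by exists 0; rewrite s0; split; lia.
  exists (f 0); split=> [|a lt_as|a b lt_as lt_bs].
  - by rewrite szW; have := f_lt (size s).-1; rewrite (fE (size s).-1); lia.
  - by apply: W_lt; rewrite -fE // f_lt.
  - by rewrite -!fE //; split; [apply: lt_p|apply: eq_p].
case=> i [szi lt_m ord_i]; exists (addn i); split=> /=.
- by move=> a lt_as; lia.
- by move=> a b; lia.
- by move=> a; lia.
- by move=> a b lt_as lt_bs; have [+ _] := ord_i a b lt_as lt_bs.
- by move=> a b lt_as lt_bs; have [_ +] := ord_i a b lt_as lt_bs.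
Qed.

(** An embedding consists of two translations around the image of the middle letter. As all letters
    of [s] and [t] lie below [l], comparison with [MidL l] yields exactly the strict bound in
    [occurs]. *)
Lemma contains_shuffle (s t : seq nat) (l k n : nat) (w : n.-tuple 'I_k) :
  {in s, forall a, a < l} -> {in t, forall a, a < l} ->
  contains (shuffle_pattern s l t) w <->
  occurs_shuffle s t (map (@nat_of_ord k) w).
Proof.
move=> s_lt t_lt; have := containsP (MidL l) (shuffle_pattern s l t) w.
set W := map _ _; have szW : size W = n by rewrite size_map size_tuple.
have -> : flatten (shuffle_pattern s l t) =
  map LeftL s ++ MidL l :: map RightL t by rewrite /= cats0.
have -> : pogp_size (shuffle_pattern s l t) = size s + (size t).+1.
  by rewrite /pogp_size /= cats0 size_cat /= !size_map.
move=> /= ->; set p := nth _ _.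
have pL a : a < size s -> p a = LeftL (nth 0 s a).
  by move=> lt_as; rewrite /p nth_cat size_map lt_as (nth_map 0).
have pM : p (size s) = MidL l by rewrite /p nth_cat size_map ltnn subnn.
have pR a : a < size t -> p ((size s).+1 + a) = RightL (nth 0 t a).
  move=> lt_at; rewrite /p nth_cat size_map ifF; last by lia.
  by rewrite (_ : _ - _ = a.+1) /= ?(nth_map 0) //; lia.
have sfE a : a.+1 < size s + (size t).+1 ->
    same_factor (shuffle_pattern s l t) a a.+1 = (a.+1 < size s) || (size s < a).
  (* The two booleans add up to the factor index: 0 for [s], 1 for the middle letter, 2 for [t]. *)
  have idxE b : b < size s + (size t).+1 ->
      reshape_index (shape (shuffle_pattern s l t)) b =
      (size s <= b) + (size s < b).
    move=> lt_br; rewrite /reshape_index /= !size_map.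
    by case: ifPn => ?; [|case: ifPn => ?; [|case: ifPn => ?]]; lia.
  by move=> lt_ar; rewrite /same_factor !idxE; lia.
split.
  case=> f [f_lt incr adj lt_p eq_p].
  have fL a : a < size s -> f a = f 0 + a.
    apply: (@consecutive f 0) => b _ lt_bs; apply: adj; [|rewrite sfE]; lia.
  have fR a : a < size t -> f ((size s).+1 + a) = f (size s).+1 + a.
    move=> lt_at; apply: (@consecutive f _ (size s + (size t).+1)); last by lia.
    by move=> b lt_sb lt_br; apply: adj; rewrite ?sfE; lia.
  have lt_f : f (size s) < size W by rewrite szW f_lt //; lia.
  (* The word is cut at the image of the middle letter. *)
  exists (take (f (size s)) W), (nth 0 W (f (size s))), (drop (f (size s)).+1 W).
  split.
  - by rewrite -drop_nth // cat_take_drop.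
  - have [s0|s_gt0] := posnP (size s); first by exists 0; rewrite s0; split; lia.
    have lt_fs a : a < size s -> f 0 + a < f (size s).
      by move=> lt_as; rewrite -fL // incr //; lia.
    exists (f 0); split=> [|a lt_as|a b lt_as lt_bs].
    + by rewrite size_takel; [have := lt_fs (size s).-1; lia | lia].
    + rewrite nth_take ?lt_fs // -fL //; apply: lt_p; [lia|lia|].
      by rewrite pL // pM shuffle_ltE; apply: s_lt; apply: mem_nth.
    + rewrite !nth_take ?lt_fs // -!fL //; split.
        move=> lt_ab; apply: lt_p; [lia|lia|rewrite !pL //].
        by rewrite shuffle_ltE.
      by move=> eq_ab; apply: eq_p; [lia|lia|rewrite !pL // eq_ab].
  - have [t0|t_gt0] := posnP (size t); first by exists 0; rewrite t0; split; lia.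
    have lt_ft : f (size s) < f (size s).+1 by apply: incr; lia.
    have nthE a : a < size t ->
      nth 0 (drop (f (size s)).+1 W) (f (size s).+1 - (f (size s)).+1 + a) =
      nth 0 W (f ((size s).+1 + a)).
      by move=> lt_at; rewrite nth_drop fR //; congr nth; lia.
    exists (f (size s).+1 - (f (size s)).+1); split=> [|a lt_at|a b lt_at lt_bt].
    + have := f_lt ((size s).+1 + (size t).-1); rewrite size_drop szW (fR (size t).-1); lia.
    + rewrite nthE //; apply: lt_p; [lia|lia|].
      by rewrite pR // pM shuffle_ltE; apply: t_lt; apply: mem_nth.
    + rewrite !nthE //; split.
        move=> lt_ab; apply: lt_p; [lia|lia|rewrite !pR //].
        by rewrite shuffle_ltE.
      by move=> eq_ab; apply: eq_p; [lia|lia|rewrite !pR // eq_ab].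
case=> x [c [y [WE [i [szi lt_i ord_i]] [j [szj lt_j ord_j]]]]].
(* The embedding is glued from the three factors; positions in [y] are shifted by [(size x).+1],
   past [x] and [c]. *)
pose f a := if a < size s then i + a else
            if a == size s then size x else (size x).+1 + j + (a - (size s).+1).
have szE : n = size x + (size y).+1 by rewrite -szW WE size_cat.
have WL a : a < size s -> nth 0 W (f a) = nth 0 x (i + a).
  by move=> lt_as; rewrite /f lt_as WE nth_cat ifT //; lia.
have WM : nth 0 W (f (size s)) = c by rewrite /f ltnn eqxx WE nth_cat ltnn subnn.
have WR a : nth 0 W (f ((size s).+1 + a)) = nth 0 y (j + a).
  rewrite /f ifF; last by lia.
  rewrite ifF; last by lia.
  rewrite WE nth_cat ifF; last by lia.
  by rewrite (_ : _ - size x = (j + a).+1) //; lia.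
have caseP a : a < size s + (size t).+1 ->
    [\/ [/\ a < size s, p a = LeftL (nth 0 s a) & nth 0 W (f a) = nth 0 x (i + a)],
        p a = MidL l /\ nth 0 W (f a) = c |
        exists b, [/\ b < size t, p a = RightL (nth 0 t b) &
                      nth 0 W (f a) = nth 0 y (j + b)]].
  move=> lt_ar; case: (ltngtP a (size s)) => [lt_as|gt_as|->].
  - by constructor 1; split; [|apply: pL|apply: WL].
  - have [b aE] : exists b, a = (size s).+1 + b by exists (a - (size s).+1); lia.
    have lt_bt : b < size t by lia.
    by constructor 3; exists b; rewrite aE WR pR.
  - by constructor 2.
exists f; split.
- by move=> a lt_ar; rewrite /f; do ![case: ifPn => ?]; lia.
- move=> a b lt_abr; rewrite /f.
  by do ![case: ifPn => ?]; lia.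
- move=> a lt_ar; rewrite sfE // /f.
  by do ![case: ifPn => ?]; lia.
(* Of the nine pairs of factors, those with one letter in [s] and one in [t] vanish by
   incomparability; a comparison with the middle letter is [lt_i] or [lt_j]. *)
- move=> a b /caseP[[a_lt -> ->]|[-> ->]|[a' [a_lt -> ->]]];
    case/caseP=> [[b_lt -> ->]|[-> ->]|[b' [b_lt -> ->]]]; rewrite shuffle_ltE //.
  + by apply: (ord_i _ _ _ _).1.
  + by move=> _; apply: lt_i.
  + by rewrite ltnn.
  + by move=> _; apply: lt_j.
  + by apply: (ord_j _ _ _ _).1.
- move=> a b /caseP[[a_lt -> ->]|[-> ->]|[a' [a_lt -> ->]]];
    case/caseP=> [[b_lt -> ->]|[-> ->]|[b' [b_lt -> ->]]] // [].
  + by apply: (ord_i _ _ _ _).2.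
  + by apply: (ord_j _ _ _ _).2.
Qed.

(** * Sums over words *)

Local Open Scope ring_scope.

(** With letters in [nat], words over [k] and over [k.+1] letters share one type, and concatenation
    needs no casts. *)
Fixpoint word_sum (k n : nat) (F : seq nat -> rat) : rat :=
  if n is n'.+1 then \sum_(c < k) word_sum k n' (fun w => F (nat_of_ord c :: w))
  else F [::].

Lemma eq_word_sum (k n : nat) (F G : seq nat -> rat) :
  (forall w, all (fun c => c < k)%N w -> F w = G w) -> word_sum k n F = word_sum k n G.
Proof.
elim: n F G => [|n IHn] F G eqFG /=; first exact: eqFG.
by apply: eq_bigr => c _; apply: IHn => w lt_wk; rewrite eqFG //= ltn_ord.
Qed.

Lemma word_sumD (k n : nat) (F G : seq nat -> rat) :
  word_sum k n (fun w => F w + G w) = word_sum k n F + word_sum k n G.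
Proof.
elim: n F G => [|n IHn] F G //=.
by rewrite -big_split; apply: eq_bigr => c _; rewrite IHn.
Qed.

Lemma word_sumMl (k n : nat) (a : rat) (F : seq nat -> rat) :
  word_sum k n (fun w => a * F w) = a * word_sum k n F.
Proof.
elim: n F => [|n IHn] F //=.
by rewrite mulr_sumr; apply: eq_bigr => c _; rewrite IHn.
Qed.

Lemma word_sumMr (k n : nat) (a : rat) (F : seq nat -> rat) :
  word_sum k n (fun w => F w * a) = word_sum k n F * a.
Proof.
by rewrite mulrC -word_sumMl; apply: eq_word_sum => w _; rewrite mulrC.
Qed.

Lemma word_sumB (k n : nat) (F G : seq nat -> rat) :
  word_sum k n (fun w => F w - G w) = word_sum k n F - word_sum k n G.
Proof.
rewrite word_sumD; congr (_ + _); rewrite -mulN1r -word_sumMl.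
by apply: eq_word_sum => w _; rewrite mulN1r.
Qed.

Lemma word_sum_tuple (k n : nat) (F : seq nat -> rat) :
  word_sum k n F = \sum_(w : n.-tuple 'I_k) F (map (@nat_of_ord k) w).
Proof.
elim: n F => [|n IHn] F /=.
  by rewrite (big_pred1 [tuple]) // => w; apply/esym/eqP/tuple0.
under eq_bigr => c _ do rewrite IHn.
rewrite pair_big /=.
rewrite (reindex (fun w : n.+1.-tuple 'I_k => (thead w, behead_tuple w))) /=.
  by apply: eq_bigr => w _; rewrite {3}[w]tuple_eta.
exists (fun cw : 'I_k * n.-tuple 'I_k => cons_tuple cw.1 cw.2) => [w|[c w]] _ /=.
  by rewrite [RHS]tuple_eta.
by congr pair; apply: val_inj.
Qed.

(* Splits the words containing the letter [k] at its first occurrence. *)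
Lemma word_sum_first_max (k n : nat) (F : seq nat -> rat) :
  word_sum k.+1 n F = word_sum k n F +
    \sum_(i < n) word_sum k i (fun u => word_sum k.+1 (n - i.+1) (fun v => F (u ++ k :: v))).
Proof.
elim: n F => [|n IHn] F /=; first by rewrite big_ord0 addr0.
(* A first letter [k] gives the term [i = 0]; a first letter [c < k] is prepended to the
   decomposition of the remaining word. *)
rewrite big_ord_recr big_ord_recl /= subSS subn0 [X in _ = _ + X]addrC addrA.
congr (_ + _); rewrite exchange_big -big_split /=.
by apply: eq_bigr => c _; rewrite IHn.
Qed.

(** * Generating functions and their recurrences *)

(** The alphabet is kept separate from [P], so that [occurs s k] can also be counted over [k.+1]
    letters, which is the auxiliary series [B]. *)
Definition avoiding_gf (k : nat) (P : seq nat -> Prop) : fps rat :=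
  FPS (fun n => word_sum k n (fun w => (~~ `[< P w >])%:R)).

Lemma avoid_gf_avoiding (d : Order.disp_t) (T : porderType d) (pi : pogp T) (k : nat)
    (P : seq nat -> Prop) :
  (forall n (w : n.-tuple 'I_k), contains pi w <-> P (map (@nat_of_ord k) w)) ->
  avoid_gf pi k = avoiding_gf k P.
Proof.
move=> piP; apply: fpsP => n /=; rewrite word_sum_tuple /avoid_count -sum1_card.
rewrite natr_sum big_mkcond /=; apply: eq_bigr => w _; rewrite inE.
have -> : `[< P [seq nat_of_ord i | i <- w] >] = contains pi w.
  by apply/asboolP/idP => /piP.
by case: contains.
Qed.

Lemma coef_fpsD (f g : fps rat) (n : nat) :
  fps_coef (f + g) n = fps_coef f n + fps_coef g n.
Proof. by []. Qed.

Lemma coef_fpsXM (f : fps rat) (n : nat) :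
  fps_coef (fpsX * f) n = if n is m.+1 then fps_coef f m else 0.
Proof.
case: n => [|n] /=; first by rewrite big_ord_recl big_ord0 /= mul0r addr0.
rewrite 2!big_ord_recl /= mul0r add0r mul1r subSS subn0 big1 ?addr0 //.
by move=> i _; rewrite mul0r.
Qed.

Lemma coef_fpsXMM (f g : fps rat) (n : nat) :
  fps_coef (fpsX * f * g) n =
  \sum_(i < n) fps_coef f i * fps_coef g (n - i.+1)%N.
Proof.
rewrite -mulrA coef_fpsXM; case: n => [|n] /=; first by rewrite big_ord0.
by apply: eq_bigr => i _; rewrite subSS.
Qed.

(** No occurrence below [k] uses the letter [k], so [u ++ k :: v] avoids exactly when [u] and [v]
    both do: the indicators multiply, and [fpsX] accounts for the cut letter. *)
Lemma avoiding_gf_occurs_rec (s : seq nat) (k : nat) :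
  avoiding_gf k.+1 (occurs s k) =
  avoiding_gf k (occurs s k) + fpsX * avoiding_gf k (occurs s k) * avoiding_gf k.+1 (occurs s k).
Proof.
apply: fpsP => n; rewrite coef_fpsD coef_fpsXMM.
rewrite /= word_sum_first_max; congr (_ + _); apply: eq_bigr => i _.
rewrite -word_sumMr; apply: eq_word_sum => u _; rewrite -word_sumMl; apply: eq_word_sum => v _.
rewrite -natrM mulnb -negb_or; congr (~~ _)%:R.
apply/asboolP/orP => [/occurs_split[]// H|[]/asboolP H].
- by left; apply/asboolP.
- by right; apply/asboolP.
- exact: occurs_catl.
- by apply: occurs_catr; rewrite -cat1s; apply: occurs_catr.
Qed.

(** If [u] avoids [s], then [v] need only avoid the shuffle. If [u] contains [s] but avoids the
    shuffle, then [v] must avoid [t], which already excludes the shuffle from [v]. *)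
Lemma avoiding_gf_occurs_shuffle_rec (s t : seq nat) (k : nat) :
  avoiding_gf k.+1 (occurs_shuffle s t) =
  avoiding_gf k (occurs_shuffle s t) +
  (fpsX * avoiding_gf k (occurs s k) * avoiding_gf k.+1 (occurs_shuffle s t) +
   fpsX * (avoiding_gf k (occurs_shuffle s t) - avoiding_gf k (occurs s k)) *
     avoiding_gf k.+1 (occurs t k)).
Proof.
apply: fpsP => n.
rewrite !coef_fpsD !coef_fpsXMM -big_split.
rewrite /= word_sum_first_max; congr (_ + _); apply: eq_bigr => i _.
rewrite -word_sumB -!word_sumMr -word_sumD; apply: eq_word_sum => u lt_uk.
rewrite -!word_sumMl -word_sumD; apply: eq_word_sum => v lt_vk.
have le_uk : all (fun c => c < k.+1)%N u by apply: sub_all lt_uk => c /ltnW.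
have splitP := occurs_shuffle_split s t lt_uk lt_vk.
have : `[< occurs_shuffle s t u >] -> `[< occurs s k u >].
  by move/asboolP/(occurs_shuffle_l le_uk) => ?; apply/asboolP.
have : `[< occurs_shuffle s t v >] -> `[< occurs t k v >].
  by move/asboolP/(occurs_shuffle_r lt_vk) => ?; apply/asboolP.
have -> : `[< occurs_shuffle s t (u ++ k :: v) >] =
  [|| `[< occurs_shuffle s t u >], `[< occurs_shuffle s t v >] |
      `[< occurs s k u >] && `[< occurs t k v >]].
  rewrite -asbool_and -!asbool_or; apply: asbool_equiv_eq; rewrite splitP.
  by split=> [[]|[|[]]]; [left|right; left|right; right|constructor 1
    |constructor 2|constructor 3].
(* The indicator identity is checked on all truth values; [su] and [tv] exclude the combinations
   where it could fail. *)
by do 4![case: `[< _ >]] => /= tv su //; first [ring | have := tv isT | have := su isT].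
Qed.

Unset Implicit Arguments.

Theorem mainTheorem3 (tau nu : seq nat) (l k : nat)
    (tau_pattern : generalized_pattern [:: tau])
    (nu_pattern : generalized_pattern [:: nu])
    (l_gt0 : (0 < l)%N)
    (tau_lt_l : forall a : nat, a \in tau -> (a < l)%N)
    (nu_lt_l : forall a : nat, a \in nu -> (a < l)%N)
    (le_l_k : (l <= k)%N) :
  let phi := shuffle_pattern tau l nu in
  let A_tau := avoid_gf ([:: tau] : pogp nat) in
  let A_nu := avoid_gf ([:: nu] : pogp nat) in
  let A_phi := avoid_gf phi in
  A_phi k =
    ((1 - fpsX * A_tau (k - 1)%N) * (1 - fpsX * A_nu (k - 1)%N))^-1
    * (A_phi (k - 1)%N - fpsX * A_tau (k - 1)%N * A_nu (k - 1)%N).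
Proof.
case: k le_l_k => [|k _]; first by rewrite leqNgt l_gt0.
rewrite subn1 /= !(avoid_gf_avoiding (fun n w => contains_factor _ w)).
rewrite !(avoid_gf_avoiding (fun n w => contains_shuffle w tau_lt_l nu_lt_l)).
have := avoiding_gf_occurs_rec nu k; have := avoiding_gf_occurs_shuffle_rec tau nu k.
set T := avoiding_gf k (occurs tau k); set N := avoiding_gf k (occurs nu k).
set P := avoiding_gf k (occurs_shuffle tau nu); set P' := avoiding_gf k.+1 _.
set N' := avoiding_gf k.+1 _ => P'E N'E; set D := (1 - fpsX * T) * (1 - fpsX * N).
(* Both factors have constant coefficient 1, so the inverse is genuine and not the conventional
   value at a non-unit. *)
have D_unit : D \is a GRing.unit.
  have coef0 f : fps_coef (1 - fpsX * f : fps rat) 0 = 1.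
    have -> : fps_coef (1 - fpsX * f) 0 = 1 - fps_coef (fpsX * f) 0 by [].
    by rewrite coef_fpsXM subr0.
  rewrite unitrM; apply/andP; split.
    by change (fps_coef (1 - fpsX * T) 0 \is a GRing.unit); rewrite coef0 unitr1.
  by change (fps_coef (1 - fpsX * N) 0 \is a GRing.unit); rewrite coef0 unitr1.
apply: (mulrI D_unit); rewrite mulVKr // /D.
have P'E0 : P' - (P + (fpsX * T * P' + fpsX * (P - T) * N')) = 0.
  by rewrite {1}P'E subrr.
have N'E0 : N' - (N + fpsX * N * N') = 0 by rewrite {1}N'E subrr.
apply/eqP; rewrite -subr_eq0; apply/eqP.
(* The multipliers [1 - fpsX * N] and [fpsX * (P - T)] are chosen so that the terms in [N'] cancel
   between the two recurrences. *)
transitivity ((1 - fpsX * N) * (P' - (P + (fpsX * T * P' + fpsX * (P - T) * N')))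
   + fpsX * (P - T) * (N' - (N + fpsX * N * N'))); first by ring.
by rewrite P'E0 N'E0 !mulr0 addr0.
Qed.
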